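(* Let $H$ be a complex Hilbert space and let $T$ be a positive closed operator in $H$ (i.e. $T$ is densely defined, closed, $T=T^*$ and $\langle Tx,x\rangle\geq 0$ for all $x\in D(T)$). Then for each $\epsilon>0$ there exists a bounded operator $S\in\mathcal B(H)$ such that (1) $\|S\|\leq\epsilon$; (2) $T+S$ (with domain $D(T)$) is minimum attaining; (3) $\theta(S+T,T)\leq\epsilon$.
   Context: Hilbert spaces are complex and infinite dimensional. For a densely defined closed operator $A$ with domain $D(A)$, the minimum modulus is $m(A)=\inf\{\|Ax\|: x\in D(A),\ \|x\|=1\}$, and $A$ is called minimum attaining if there exists $x_0\in D(A)$ with $\|x_0\|=1$ and $\|Ax_0\|=m(A)$. The graph of $A$ is $G(A)=\{(Ax,x):x\in D(A)\}$; the gap between densely defined closed operators $A,B$ is $\theta(A,B)=\|P_{G(A)}-P_{G(B)}\|$, where $P_M$ is the orthogonal projection onto the closed subspace $M$. *)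

(* Defs.v *)
From HB Require Import structures.
From mathcomp Require Import all_boot all_order all_algebra.
From mathcomp Require Import complex.
From mathcomp Require Import boolp classical_sets reals.
Set Implicit Arguments. Unset Strict Implicit. Unset Printing Implicit Defensive.
Import Order.TTheory GRing.Theory Num.Theory.
Local Open Scope ring_scope.
Local Open Scope classical_set_scope.

Section Hilbert.
Variables (R : realType) (V : lmodType R[i]) (ip : V -> V -> R[i]).

Definition hnorm (x : V) : R := Num.sqrt (complex.Re (ip x x)).

Definition hconv (u : nat -> V) (l : V) : Prop :=
  forall e : R, 0 < e -> exists N : nat, forall n, (N <= n)%N -> hnorm (u n - l) < e.

Definition hcauchy (u : nat -> V) : Prop :=
  forall e : R, 0 < e -> exists N : nat, forall m n, (N <= m)%N -> (N <= n)%N ->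
    hnorm (u m - u n) < e.

(* ip is a complex inner product (linear in the first, conjugate linear in
   the second argument), V is complete for the induced norm, and V is
   infinite dimensional (standing assumption of the paper). *)
Definition is_inner_product : Prop :=
  [/\ forall a x y z, ip (a *: x + y) z = a * ip x z + ip y z,
      forall x y, ip y x = conjc (ip x y),
      forall x, 0 <= ip x x &
      forall x, ip x x = 0 -> x = 0].

Definition complete : Prop :=
  forall u, hcauchy u -> exists l, hconv u l.

Definition infinite_dimensional : Prop :=
  forall (n : nat) (v : 'I_n -> V), exists x : V,
    forall c : 'I_n -> R[i], x <> \sum_(i < n) c i *: v i.

Definition complex_Hilbert_space : Prop :=
  [/\ is_inner_product, complete & infinite_dimensional].

(* an (unbounded) operator is a pair: domain D and map T (values off D irrelevant) *)
Definition subspace (D : set V) : Prop :=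
  D 0 /\ forall a x y, D x -> D y -> D (a *: x + y).

Definition densely_defined (D : set V) (T : V -> V) : Prop :=
  [/\ subspace D,
      (forall a x y, D x -> D y -> T (a *: x + y) = a *: T x + T y) &
      forall x (e : R), 0 < e -> exists y, D y /\ hnorm (x - y) < e].

Definition closed_operator (D : set V) (T : V -> V) : Prop :=
  densely_defined D T /\
  forall (u : nat -> V) x y, (forall n, D (u n)) -> hconv u x ->
    hconv (fun n => T (u n)) y -> D x /\ T x = y.

Definition adjoint_rel (D : set V) (T : V -> V) (y z : V) : Prop :=
  forall x, D x -> ip (T x) y = ip x z.

Definition self_adjoint (D : set V) (T : V -> V) : Prop :=
  forall y z, adjoint_rel D T y z <-> (D y /\ z = T y).

Definition positive_closed_operator (D : set V) (T : V -> V) : Prop :=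
  [/\ closed_operator D T, self_adjoint D T &
      forall x, D x -> 0 <= ip (T x) x].

Definition minimum_modulus (D : set V) (A : V -> V) : R :=
  inf [set hnorm (A x) | x in [set x | D x /\ hnorm x = 1]].

Definition minimum_attaining (D : set V) (A : V -> V) : Prop :=
  exists x0, [/\ D x0, hnorm x0 = 1 & hnorm (A x0) = minimum_modulus D A].

Definition ip2 (z w : V * V) : R[i] := ip z.1 w.1 + ip z.2 w.2.
Definition hnorm2 (z : V * V) : R := Num.sqrt (complex.Re (ip2 z z)).

Definition graph (D : set V) (A : V -> V) : set (V * V) :=
  [set z | exists x, D x /\ z = (A x, x)].

Definition orth_proj (M : set (V * V)) (P : V * V -> V * V) : Prop :=
  forall z, M (P z) /\ forall m, M m -> ip2 (z - P z) m = 0.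

(* theta(A,B) <= e, with theta(A,B) = || P_G(A) - P_G(B) ||  (operator norm) *)
Definition gap_le (DA : set V) (A : V -> V) (DB : set V) (B : V -> V) (e : R) : Prop :=
  forall P Q, orth_proj (graph DA A) P -> orth_proj (graph DB B) Q ->
    forall z, hnorm2 (P z - Q z) <= e * hnorm2 z.

End Hilbert.

(* Main.v *)
(* Let m be the minimum modulus of T. Positivity gives <Tx, x> >= m |x|^2 on D,
   so a unit vector x0 in D with |T x0| close to m is an approximate
   eigenvector: v = T x0 - <T x0, x0> x0 and <T x0, x0> - m are both small.
   Removing the off-diagonal part of T along x0 and replacing <T x0, x0> by m
   is a small perturbation S, and <(T + S)x, x> >= m |x|^2 still holds while
   (T + S)x0 = m x0, so T + S attains its minimum modulus m at x0.
   If s bounds the norm of S, the gap is at most sqrt (2 s); this crude estimate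
   suffices since s can be chosen below eps^2 / 2. *)
Require Import Defs.
From HB Require Import structures.
From mathcomp Require Import all_boot all_order all_algebra.
From mathcomp Require Import complex.
From mathcomp Require Import boolp classical_sets reals.
From mathcomp Require Import ring lra.
Set Implicit Arguments. Unset Strict Implicit. Unset Printing Implicit Defensive.
Import Order.TTheory GRing.Theory Num.Theory.
Local Open Scope ring_scope.
Local Open Scope classical_set_scope.

(** A nonnegative quadratic has nonpositive discriminant: evaluate it at its minimizer [- b / c].
    This serves both Cauchy-Schwarz inequalities and the orthogonality of the best-approximation
    residual. *)
Lemma sqr_le_of_quadratic_ge0 (R : realFieldType) (a b c : R) : 0 <= a -> 0 <= c ->
  (forall r, 0 <= a + 2 * r * b + r ^+ 2 * c) -> b ^+ 2 <= a * c.
Proof.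
move=> a0 c0 H; have [c_eq0|c_neq0] := eqVneq c 0.
  have [->|b0] := eqVneq b 0; first by rewrite expr0n mulr_ge0.
  (* For [c = 0] and [b] nonzero the function is affine; this [r] gives it the value -1. *)
  have := H (- (a + 1) / (2 * b)).
  suff -> : a + 2 * (- (a + 1) / (2 * b)) * b + (- (a + 1) / (2 * b)) ^+ 2 * c = -1 by lra.
  by rewrite c_eq0; field.
have c_gt0 : 0 < c by rewrite lt_def c_neq0.
have := H (- b / c).
have -> : a + 2 * (- b / c) * b + (- b / c) ^+ 2 * c = (a * c - b ^+ 2) / c by field.
by rewrite pmulr_lge0 ?invr_gt0// subr_ge0.
Qed.

(** * Cauchy-Schwarz and best approximation in a complex inner product space *)

Section InnerProduct.
Variables (R : realType) (V : lmodType R[i]) (ip : V -> V -> R[i]).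
Hypothesis Hip : is_inner_product ip.
Local Notation rip x y := (complex.Re (ip x y)).
Local Notation N := (hnorm ip).

Lemma ReD (a b : R[i]) : complex.Re (a + b) = complex.Re a + complex.Re b.
Proof. by case: a; case: b. Qed.

Lemma ReN (a : R[i]) : complex.Re (- a) = - complex.Re a.
Proof. by case: a. Qed.

Lemma ReM_real (r : R) (a : R[i]) : complex.Re (r%:C%C * a) = r * complex.Re a.
Proof. by case: a => a b /=; rewrite mul0r subr0. Qed.

Lemma ipC x y : ip y x = conjc (ip x y). Proof. by case: Hip. Qed.

Lemma ipDl x y z : ip (x + y) z = ip x z + ip y z.
Proof. by case: Hip => lin _ _ _; rewrite -[x]scale1r lin mul1r scale1r. Qed.

Lemma ip0l z : ip 0 z = 0.
Proof. by apply: (@addrI _ (ip 0 z)); rewrite -ipDl !addr0. Qed.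

Lemma ipZl a x z : ip (a *: x) z = a * ip x z.
Proof. by case: Hip => lin _ _ _; rewrite -[a *: x]addr0 lin ip0l addr0. Qed.

Lemma ipNl x z : ip (- x) z = - ip x z.
Proof. by rewrite -scaleN1r ipZl mulN1r. Qed.

Lemma ipBl x y z : ip (x - y) z = ip x z - ip y z.
Proof. by rewrite ipDl ipNl. Qed.

Lemma ipDr x y z : ip z (x + y) = ip z x + ip z y.
Proof. by rewrite (ipC (x + y)) (ipC x) (ipC y) ipDl rmorphD. Qed.

Lemma ipZr a x z : ip z (a *: x) = conjc a * ip z x.
Proof. by rewrite (ipC (a *: x)) (ipC x) ipZl rmorphM. Qed.

Lemma ipNr x z : ip z (- x) = - ip z x.
Proof. by rewrite (ipC (- x)) (ipC x) ipNl rmorphN. Qed.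

Lemma ipBr x y z : ip z (x - y) = ip z x - ip z y.
Proof. by rewrite ipDr ipNr. Qed.

Lemma rip_sym x y : rip x y = rip y x.
Proof. by rewrite (ipC y x); case: (ip y x). Qed.

Lemma rip_ge0 x : 0 <= rip x x.
Proof. by case: Hip => _ _ /(_ x); rewrite lecE => /andP[]. Qed.

Lemma ip_self x : ip x x = (rip x x)%:C%C.
Proof.
case: Hip => _ _ /(_ x); rewrite lecE => /andP[/eqP] + _ _.
by case: (ip x x) => a b /= ->.
Qed.

Lemma hnorm_ge0 x : 0 <= N x. Proof. exact: sqrtr_ge0. Qed.

Lemma hnorm_sqr x : N x ^+ 2 = rip x x.
Proof. by rewrite sqr_sqrtr// rip_ge0. Qed.

Lemma hnorm_eq0 x : N x = 0 -> x = 0.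
Proof.
by move=> x0; case: Hip => _ _ _; apply; rewrite ip_self -hnorm_sqr x0 expr0n.
Qed.

Lemma hnorm0 : N 0 = 0. Proof. by rewrite /hnorm ip0l sqrtr0. Qed.

Lemma hnormN x : N (- x) = N x.
Proof. by rewrite /hnorm ipNl ipNr opprK. Qed.

Lemma hnorm_distC x y : N (x - y) = N (y - x).
Proof. by rewrite -opprB hnormN. Qed.

Lemma hnormD_sqr x y : N (x + y) ^+ 2 = N x ^+ 2 + 2 * rip x y + N y ^+ 2.
Proof. by rewrite !hnorm_sqr !ipDl !ipDr !ReD (rip_sym y x); ring. Qed.

Lemma hnormZ_real (r : R) x : N (r%:C%C *: x) = `|r| * N x.
Proof.
apply/eqP; rewrite -(@eqrXn2 _ 2)// ?mulr_ge0 ?hnorm_ge0//.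
by rewrite exprMn real_normK ?num_real// !hnorm_sqr ipZl ipZr conjc_real !ReM_real; apply/eqP; ring.
Qed.

Lemma cauchy_schwarz x y : rip x y <= N x * N y.
Proof.
apply: le_trans (ler_norm _) _.
rewrite -(@ler_pXn2r _ 2)// ?nnegrE ?mulr_ge0 ?hnorm_ge0//.
rewrite real_normK ?num_real// exprMn; apply: sqr_le_of_quadratic_ge0; rewrite ?sqr_ge0// => r.
have := sqr_ge0 (N (x + r%:C%C *: y)).
rewrite hnormD_sqr hnormZ_real exprMn real_normK ?num_real// ipZr conjc_real ReM_real.
by rewrite mulrA.
Qed.

Lemma hnormD x y : N (x + y) <= N x + N y.
Proof.
rewrite -(@ler_pXn2r _ 2)// ?nnegrE ?addr_ge0 ?hnorm_ge0//.
by rewrite hnormD_sqr; have := cauchy_schwarz x y; nra.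
Qed.

(** This amounts to Cauchy-Schwarz for the modulus of [ip x y]. With [K] its square, the real-part
    version applied to [conjc (ip x y) *: x] and [y] gives [K ^+ 2 <= K * N x ^+ 2 * N y ^+ 2], and
    [K] cancels. *)
Lemma hnorm_rank_one x y z : N (ip x y *: z) <= N x * N y * N z.
Proof.
pose K := complex.Re (conjc (ip x y) * ip x y).
have K0 : 0 <= K by rewrite /K; case: (ip x y) => a b /=; rewrite mulNr opprK addr_ge0 ?sqr_ge0 -?expr2 ?sqr_ge0.
have NZ w : N (ip x y *: w) ^+ 2 = K * N w ^+ 2.
  rewrite !hnorm_sqr ipZl ipZr ip_self /K.
  by case: (ip x y) => a b /=; ring.
have NZ' : N (conjc (ip x y) *: x) ^+ 2 = K * N x ^+ 2.
  rewrite !hnorm_sqr ipZl ipZr ip_self /K.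
  by case: (ip x y) => a b /=; ring.
have K_le : K <= N (conjc (ip x y) *: x) * N y.
  by rewrite /K -ipZl; exact: cauchy_schwarz.
have KK : K <= N x ^+ 2 * N y ^+ 2.
  have [->|Kn0] := eqVneq K 0; first by rewrite mulr_ge0 ?sqr_ge0.
  have Kgt : 0 < K by rewrite lt_def Kn0.
  rewrite -(ler_pM2l Kgt) mulrA -NZ' -exprMn -expr2.
  by rewrite ler_pXn2r// ?nnegrE ?mulr_ge0 ?hnorm_ge0.
rewrite -(@ler_pXn2r _ 2)// ?nnegrE ?mulr_ge0 ?hnorm_ge0//.
by rewrite NZ !exprMn ler_wpM2r ?sqr_ge0.
Qed.

Lemma ip_eq0_of_rip u w : (forall a, rip u (a *: w) = 0) -> ip u w = 0.
Proof.
(* For [a = ip u w] the real part is the squared modulus of [ip u w]. *)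
move=> /(_ (ip u w)); rewrite ipZr; case: (ip u w) => a b /= h.
have h2 : a ^+ 2 + b ^+ 2 = 0 by rewrite -h; ring.
have /eqP := h2; rewrite paddr_eq0 ?sqr_ge0// !sqrf_eq0 => /andP[/eqP-> /eqP->].
by [].
Qed.

(* The minimizing sequence for the distance from x to W is Cauchy by the
   parallelogram law; the residual at its limit is orthogonal to W. *)
Lemma closest_point (W : set V) : complete ip -> subspace W -> forall x,
  exists z, (forall e, 0 < e -> exists w, W w /\ N (w - z) < e) /\
    forall w, W w -> ip (x - z) w = 0.
Proof.
move=> cpl [W0 Wlin] x.
pose E : set R := [set N (x - w) | w in W].
have lbE : lbound E 0 by move=> _ [w _ <-]; exact: hnorm_ge0.
have infE : has_inf E by split; [exists (N (x - 0)); exists 0|exists 0].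
pose d := inf E.
have d0 : 0 <= d by apply: lb_le_inf => //; case: infE.
have d_le w : W w -> d <= N (x - w).
  by move=> Ww; apply: ge_inf; [case: infE|exists w].
have ex_w n : exists w, W w /\ N (x - w) < d + n.+1%:R^-1.
  have [_ [w Ww <-] lt_w] := @inf_adherent _ E n.+1%:R^-1 ltac:(by rewrite invr_gt0) infE.
  by exists w.
have [u Hu] := choice ex_w.
have small e : 0 < e -> exists n0, forall n, (n0 <= n)%N -> N (x - u n) < d + e.
  move=> e0; exists (Num.truncn e^-1) => n le_n.
  apply: lt_le_trans (Hu n).2 _; rewrite lerD2l.
  rewrite -[e]invrK lef_pV2 ?posrE ?invr_gt0//.
  apply: le_trans (ltW (truncnS_gt _)) _.
  by rewrite ler_nat ltnS.
have half_lin w1 w2 : W w1 -> W w2 -> W ((2^-1)%:C%C *: (w1 + w2)).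
  move=> W1 W2; rewrite -[X in W X]addr0; apply: (Wlin) => //.
  by rewrite -[w1]scale1r; apply: (Wlin).
have cau : hcauchy ip u.
  move=> e e0.
  (* By the parallelogram law the squared distance is below [4 * (d + c) ^+ 2 - 4 * d ^+ 2 = 4 * c *
     (2 * d + c)]; since [c <= 1], this is less than [e ^+ 2]. *)
  pose c := e ^+ 2 / (4 * (2 * d + 1 + e ^+ 2)).
  have ee0 : 0 < e ^+ 2 by rewrite exprn_gt0.
  have den0 : 0 < 4 * (2 * d + 1 + e ^+ 2) by lra.
  have c0 : 0 < c by rewrite divr_gt0.
  have cE : c * (4 * (2 * d + 1 + e ^+ 2)) = e ^+ 2 by rewrite divfK// gt_eqF.
  have c1 : c <= 1 by rewrite ler_pdivrMr//; lra.
  have [n0 Hn0] := small c c0; exists n0 => m n /Hn0 um /Hn0 un.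
  rewrite -(@ltr_pXn2r _ 2)// ?nnegrE ?hnorm_ge0 ?(ltW e0)//.
  (* The midpoint lies in [W], so its distance to [x] is at least [d]. *)
  have dm := d_le _ (half_lin _ _ (Hu m).1 (Hu n).1).
  have par : N (u m - u n) ^+ 2 + 4 * N (x - (2^-1)%:C%C *: (u m + u n)) ^+ 2
     = 2 * N (x - u m) ^+ 2 + 2 * N (x - u n) ^+ 2.
    have -> : 4 * N (x - (2^-1)%:C%C *: (u m + u n)) ^+ 2
       = N ((x - u m) + (x - u n)) ^+ 2.
      have -> : (x - u m) + (x - u n) = (2%:R : R)%:C%C *: (x - (2^-1)%:C%C *: (u m + u n)).
        rewrite scalerBr scalerA -rmorphM /= mulfV ?pnatr_eq0// scale1r.
        by rewrite rmorph_nat scaler_nat mulr2n opprD addrACA.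
      by rewrite hnormZ_real exprMn real_normK ?num_real//; ring.
    have -> : u m - u n = (x - u n) + - (x - u m) by rewrite opprB [RHS]addrC subrKA.
    move: (x - u m) (x - u n) => p q.
    by rewrite !hnormD_sqr hnormN ipNr ReN (rip_sym q); ring.
  have := hnorm_ge0 (x - u m); have := hnorm_ge0 (x - u n).
  move: (N (x - u m)) (N (x - u n)) (N (x - _)) (N (_ - _)) um un dm par => p q r s; nra.
have [z uz] := cpl _ cau; exists z; split.
  by move=> e /uz[n0 /(_ n0 (leqnn _)) h]; exists (u n0); split => //; exact: (Hu n0).1.
have d_ge : N (x - z) <= d.
  apply/ler_addgt0Pr => e e0.
  have e20 : 0 < e / 2 by rewrite divr_gt0.
  have [n1 h1] := small _ e20; have [n2 h2] := uz _ e20.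
  have := h1 (maxn n1 n2) (leq_maxl _ _); have := h2 (maxn n1 n2) (leq_maxr _ _).
  by have := hnormD (x - u (maxn n1 n2)) (u (maxn n1 n2) - z); rewrite subrKA; lra.
(* Only a limit of points of [W], [z] need not lie in [W]; the bound is obtained from [u n0 - w] by
   approximation. *)
have d_le' w : W w -> d <= N (x - z + w).
  move=> Ww; apply/ler_addgt0Pr => e /uz[n0 /(_ n0 (leqnn _)) h].
  have Ww' : W (u n0 - w) by rewrite addrC -scaleN1r; apply: (Wlin) => //; exact: (Hu n0).1.
  apply: le_trans (d_le _ Ww') _.
  have -> : x - (u n0 - w) = (x - z + w) + (z - u n0).
    by rewrite opprB [RHS]addrAC subrKA addrA addrAC -addrA.
  apply: le_trans (hnormD _ _) _; rewrite lerD2l hnorm_distC; exact: ltW.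
move=> w Ww; apply: ip_eq0_of_rip => a.
have {Ww} : W (a *: w) by rewrite -[_ *: _]addr0; exact: Wlin.
move: (a *: w) => {}w Ww.
(* Minimality along [r *: w] gives a nonnegative quadratic in [r] with zero constant term, so its
   linear coefficient vanishes. *)
apply/eqP; rewrite -sqrf_eq0 eq_le sqr_ge0 andbT -(mul0r (N w ^+ 2)).
apply: sqr_le_of_quadratic_ge0; rewrite ?sqr_ge0// => r.
have Wr : W (r%:C%C *: w) by rewrite -[_ *: _]addr0; exact: Wlin.
have := d_le' _ Wr; move/(le_trans d_ge).
rewrite -(@ler_pXn2r _ 2)// ?nnegrE ?hnorm_ge0//.
rewrite (hnormD_sqr (x - z)) hnormZ_real exprMn real_normK ?num_real// ipZr conjc_real ReM_real.
by lra.
Qed.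

End InnerProduct.

(** * The gap between an operator and its bounded perturbation *)

Section Gap.
Variables (R : realType) (V : lmodType R[i]) (ip : V -> V -> R[i]).
Hypothesis Hip : is_inner_product ip.
Local Notation N := (hnorm ip).
Local Notation N2 := (hnorm2 ip).

(** Makes the preceding inner product results available on [V * V], where the graphs live. *)
Lemma ip2_inner_product : is_inner_product (ip2 ip).
Proof.
case: (Hip) => lin sym pos def; split.
- by move=> a x y z; rewrite /ip2 /= !lin; ring.
- by move=> x y; rewrite /ip2 rmorphD (sym x.1) (sym x.2).
- by move=> x; rewrite /ip2 addr_ge0.
- move=> [x y]; rewrite /ip2 /= => /eqP; rewrite paddr_eq0//.
  by move=> /andP[/eqP/def-> /eqP/def->].
Qed.

Let Hip2 := ip2_inner_product.

Lemma hnorm2_sqr z : N2 z ^+ 2 = N z.1 ^+ 2 + N z.2 ^+ 2.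
Proof. by rewrite (hnorm_sqr Hip2) !(hnorm_sqr Hip) /ip2 ReD. Qed.

Lemma orth_proj_sqr M P z : orth_proj ip M P ->
  N2 z ^+ 2 = N2 (z - P z) ^+ 2 + N2 (P z) ^+ 2.
Proof.
move=> /(_ z)[MP /(_ _ MP) orth]; rewrite -{1}(subrK (P z) z).
by rewrite (hnormD_sqr Hip2) orth mulr0 addr0.
Qed.

(** The squared norm of [P z - Q z] is the real part of <z - Qz, Pz> + <z - Pz, Qz>. Adding or
    removing an [S] term moves a point of one graph into the other, so orthogonality leaves only
    that [S] term, and each summand is at most [s * N2 z ^+ 2]. *)
Lemma gap_le_perturbation D (T S : V -> V) (s e : R) : 0 <= e ->
  0 <= s -> 2 * s <= e ^+ 2 -> (forall x, N (S x) <= s * N x) ->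
  gap_le ip D (fun x => S x + T x) D T e.
Proof.
move=> e0 s0 se Sle P Q HP HQ z.
have Pz := orth_proj_sqr z HP; have Qz := orth_proj_sqr z HQ.
have [[x [Dx xE]] Porth] := HP z; have [[y [Dy yE]] Qorth] := HQ z.
have N2ge w : 0 <= N2 w by exact: (@hnorm_ge0 _ _ (ip2 ip)).
have PT : ip2 ip (z - P z) (T y + S y, y) = 0 by apply: Porth; exists y; rewrite addrC.
have QT : ip2 ip (z - Q z) (T x, x) = 0 by apply: Qorth; exists x.
have PP : ip2 ip (z - P z) (P z) = 0 by apply: Porth; exists x.
have QQ : ip2 ip (z - Q z) (Q z) = 0 by apply: Qorth; exists y.
have PE : P z = (T x, x) + (S x, 0) by rewrite xE [S x + _]addrC; congr (_, _) => /=; rewrite addr0.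
have QE : Q z = (T y + S y, y) - (S y, 0).
  by rewrite yE; congr (_, _) => /=; rewrite ?addrK ?subr0.
have key : N2 (P z - Q z) ^+ 2 = complex.Re (ip2 ip (z - Q z) (S x, 0))
    + complex.Re (ip2 ip (z - P z) (- S y, 0)).
  rewrite (hnorm_sqr Hip2).
  have -> : ip2 ip (P z - Q z) (P z - Q z) =
      ip2 ip (z - Q z) (P z) + ip2 ip (z - P z) (Q z).
    have {1}-> : P z - Q z = (z - Q z) - (z - P z) by rewrite opprB [RHS]addrC subrKA.
    by rewrite (ipBl Hip2) !(ipBr Hip2) PP QQ; ring.
  rewrite ReD; congr (complex.Re _ + complex.Re _).
    by rewrite PE (ipDr Hip2) QT add0r.
  rewrite QE (ipBr Hip2) PT sub0r -(ipNr Hip2); congr (ip2 _ _ (_, _)).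
  by rewrite /= oppr0.
(* Used with [w] a residual of [z] and [v] the second component of a projection of [z]; Pythagoras
   bounds both by [N2 z]. *)
have bound w v u : N2 w <= N2 z -> N v <= N2 z -> N u <= s * N v ->
    complex.Re (ip2 ip w (u, 0)) <= s * N2 z ^+ 2.
  move=> wz vz uv; apply: le_trans (cauchy_schwarz Hip2 _ _) _.
  have -> : hnorm (ip2 ip) (u, 0) = N u.
    apply/eqP; rewrite -(@eqrXn2 _ 2)// ?hnorm_ge0//.
    by apply/eqP; rewrite [LHS]hnorm2_sqr /= (hnorm0 Hip) expr0n addr0.
  rewrite expr2 mulrCA ler_pM ?hnorm_ge0//.
  by apply: le_trans uv _; rewrite ler_wpM2l.
have le_of_sqr (a b : R) : 0 <= a -> 0 <= b -> a ^+ 2 <= b ^+ 2 -> a <= b.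
  by move=> a0 b0; rewrite ler_pXn2r.
have b1 : complex.Re (ip2 ip (z - Q z) (S x, 0)) <= s * N2 z ^+ 2.
  apply: (bound _ x) => //.
    by apply: le_of_sqr => //; rewrite Qz lerDl sqr_ge0.
  apply: le_of_sqr; rewrite ?hnorm_ge0// Pz xE [N2 (_, _) ^+ 2]hnorm2_sqr /=.
  by rewrite !addrA lerDr addr_ge0 ?sqr_ge0.
have b2 : complex.Re (ip2 ip (z - P z) (- S y, 0)) <= s * N2 z ^+ 2.
  apply: (bound _ y); rewrite ?(hnormN Hip)//.
    by apply: le_of_sqr => //; rewrite Pz lerDl sqr_ge0.
  apply: le_of_sqr; rewrite ?hnorm_ge0// Qz yE [N2 (_, _) ^+ 2]hnorm2_sqr /=.
  by rewrite !addrA lerDr addr_ge0 ?sqr_ge0.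
apply: le_of_sqr; rewrite ?mulr_ge0//.
rewrite key exprMn; apply: le_trans (lerD b1 b2) _.
by rewrite -mulrDl -mulr2n -mulr_natl ler_wpM2r ?sqr_ge0.
Qed.

End Gap.

(** * Lower bounds for the quadratic form of a positive operator *)

Section PositiveOperator.
Variables (R : realType) (V : lmodType R[i]) (ip : V -> V -> R[i]).
Hypotheses (Hip : is_inner_product ip) (Hcpl : complete ip).
Variables (D : set V) (T : V -> V).
Hypothesis HT : positive_closed_operator ip D T.
Local Notation N := (hnorm ip).

Lemma op_sub : subspace D. Proof. by case: HT => [[[]]]. Qed.

Lemma op_linear a x y : D x -> D y -> T (a *: x + y) = a *: T x + T y.
Proof. by case: HT => [[[_ + _]]] => h _ _ _; exact: h. Qed.

Lemma op_symm x y : D x -> D y -> ip (T x) y = ip x (T y).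
Proof. by case: HT => _ sa _ Dx Dy; exact: (((sa y (T y)).2 (conj Dy erefl)) x Dx). Qed.

(** A residual orthogonal to the range lies in the domain of the adjoint, hence in [D], and is
    killed by [T]; boundedness below then makes it zero. *)
Lemma op_dense_range (m : R) : 0 < m -> (forall x, D x -> m * N x <= N (T x)) ->
  forall x e, 0 < e -> exists y, D y /\ N (T y - x) < e.
Proof.
move=> m0 mT x e e0.
have [D0 Dlin] := op_sub.
have T0 : T 0 = 0.
  by have := op_linear (-1) D0 D0; rewrite scaler0 addr0 scaleN1r addNr.
have subT : subspace (T @` D).
  split; first by exists 0.
  move=> a _ _ [y Dy <-] [y' Dy' <-]; exists (a *: y + y'); first exact: Dlin.
  exact: op_linear.
have [z [zcl zorth]] := closest_point Hip Hcpl subT x.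
have [Dxz Txz] : D (x - z) /\ 0 = T (x - z).
  case: HT => _ sa _; apply/sa => w Dw.
  rewrite (ipC Hip) zorth; last by exists w.
  by rewrite conjc0 (ipC Hip) (ip0l Hip) conjc0.
have xz : x = z.
  apply/eqP; rewrite -subr_eq0; apply/eqP; apply: (hnorm_eq0 Hip).
  have := mT _ Dxz; rewrite -Txz (hnorm0 Hip) pmulr_rle0// => h.
  by apply: le_anti; rewrite h hnorm_ge0.
by have [_ [[y Dy <-] h]] := zcl _ e0; exists y; rewrite xz.
Qed.

Lemma form_ge0 x : D x -> 0 <= complex.Re (ip (T x) x).
Proof. by case: HT => _ _ h /h; rewrite lecE => /andP[]. Qed.

(** The quadratic in [r] is the form of [T] at [r y + x]; symmetry of [T] merges the two cross
    terms. *)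
Lemma form_cauchy_schwarz x y : D x -> D y ->
  complex.Re (ip (T x) y) ^+ 2 <= complex.Re (ip (T x) x) * complex.Re (ip (T y) y).
Proof.
move=> Dx Dy; apply: sqr_le_of_quadratic_ge0; rewrite ?form_ge0// => r.
have [_ Dlin] := op_sub.
have := form_ge0 (Dlin r%:C%C _ _ Dy Dx).
rewrite op_linear// !(ipDl Hip) !(ipDr Hip) !(ipZl Hip) !(ipZr Hip) conjc_real.
rewrite !ReD !ReM_real (op_symm Dy Dx) (rip_sym Hip y).
by move=> h; lra.
Qed.

(* Cauchy-Schwarz for the form <T.,.>, applied to x and an approximate
   solution y of T y = x, for which <T y, y> <= |T y|^2 / m. *)
Lemma form_lower_bound (m : R) : 0 <= m -> (forall x, D x -> m * N x <= N (T x)) ->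
  forall x, D x -> m * N x ^+ 2 <= complex.Re (ip (T x) x).
Proof.
move=> m0 mT x Dx.
have [->|mn0] := eqVneq m 0; first by rewrite mul0r form_ge0.
have {}m0 : 0 < m by rewrite lt_def mn0.
have [x0|xn0] := eqVneq (N x) 0; first by rewrite x0 expr0n mulr0 form_ge0.
have Nx : 0 < N x by rewrite lt_def xn0 hnorm_ge0.
rewrite leNgt; apply/negP => lt_q.
set q := complex.Re _ in lt_q; set M := m * N x ^+ 2 in lt_q.
have q0 : 0 <= q by exact: form_ge0.
(* The estimates below lead to [M * (1 - c) ^+ 2 <= q * (1 + c) ^+ 2], which forces
   [M - q <= 2 * c * (M + q)]. If [q < M], the right side is below [4 * c * M], which is two thirds
   of [M - q] by the choice of [c]: a contradiction. *)
pose c := (M - q) / (6 * M).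
have M0 : 0 < M by rewrite /M mulr_gt0// exprn_gt0.
have cE : 6 * (c * M) = M - q by rewrite mulrCA divfK// mulf_neq0// gt_eqF.
have c0 : 0 < c by rewrite divr_gt0 ?subr_gt0// mulr_gt0.
have c1 : c <= 1 by rewrite ler_pdivrMr ?mulr_gt0//; lra.
have [y [Dy Ty]] := op_dense_range m0 mT x (mulr_gt0 c0 Nx).
have tx : (1 - c) * N x ^+ 2 <= complex.Re (ip (T y) x).
  have -> : T y = x + (T y - x) by rewrite addrC subrK.
  rewrite (ipDl Hip) ReD -(hnorm_sqr Hip).
  have := cauchy_schwarz Hip (- (T y - x)) x.
  by rewrite (ipNl Hip) ReN (hnormN Hip); nra.
have Ny : N (T y) <= (1 + c) * N x.
  have -> : T y = x + (T y - x) by rewrite addrC subrK.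
  by apply: le_trans (hnormD Hip _ _) _; lra.
have ty : m * complex.Re (ip (T y) y) <= ((1 + c) * N x) ^+ 2.
  have h1 := cauchy_schwarz Hip (T y) y; have h2 := mT _ Dy.
  have h3 := @hnorm_ge0 _ _ ip (T y); have h4 := @hnorm_ge0 _ _ ip y.
  apply: (@le_trans _ _ (N (T y) ^+ 2)); last by rewrite ler_pXn2r ?nnegrE ?mulr_ge0// ?addr_ge0// ltW.
  apply: (@le_trans _ _ (m * (N (T y) * N y))); first by rewrite ler_pM2l.
  by rewrite mulrCA expr2 ler_wpM2l.
have CS := form_cauchy_schwarz Dy Dx; rewrite -/q in CS.
have h1 : ((1 - c) * N x ^+ 2) ^+ 2 <= complex.Re (ip (T y) x) ^+ 2.
  have t0 : 0 <= (1 - c) * N x ^+ 2 by rewrite mulr_ge0 ?sqr_ge0// subr_ge0.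
  by rewrite ler_pXn2r// nnegrE// (le_trans t0).
have h2 : m * ((1 - c) * N x ^+ 2) ^+ 2 <= q * ((1 + c) * N x) ^+ 2.
  apply: (@le_trans _ _ (m * (complex.Re (ip (T y) y) * q))).
    by rewrite ler_pM2l// (le_trans h1).
  by rewrite mulrA mulrC ler_wpM2l.
have h3 : M * (1 - c) ^+ 2 <= q * (1 + c) ^+ 2.
  rewrite -(ler_pM2r (exprn_gt0 2 Nx)).
  by move: h2; rewrite /M; lra.
(* These products let the final inequality be settled linearly, with monomials as unknowns. *)
have Mq : 0 <= M - q by rewrite subr_ge0 ltW.
have cMq : 0 <= c * (M - q) by rewrite mulr_ge0// ltW.
have ccMq : 0 <= c * (c * (M - q)) by rewrite mulr_ge0// ltW.
lra.
Qed.

End PositiveOperator.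

(** Bundles a map given by a formula, so that the perturbation can have type [{linear V -> V}]. *)
Lemma linear_map (R : pzRingType) (U W : lmodType R) (f : U -> W) : linear f ->
  exists g : {linear U -> W}, g =1 f.
Proof.
move=> linf.
pose g : {linear U -> W} := HB.pack f (GRing.isLinear.Build R U W *:%R f linf).
by exists g.
Qed.

(** * Elementary properties of the minimum modulus *)

Section MinimumModulus.
Variables (R : realType) (V : lmodType R[i]) (ip : V -> V -> R[i]).
Hypothesis Hip : is_inner_product ip.
Local Notation N := (hnorm ip).
Local Notation mm := (minimum_modulus ip).

Lemma hnorm_normalize x : x <> 0 -> N ((N x)^-1%:C%C *: x) = 1.
Proof.
move=> xn0; rewrite (hnormZ_real Hip) ger0_norm ?invr_ge0 ?hnorm_ge0// mulVf//.
by apply/eqP => /(hnorm_eq0 Hip).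
Qed.

Lemma minimum_modulus_lb D (A : V -> V) x : D x -> N x = 1 -> mm D A <= N (A x).
Proof.
move=> Dx Nx; apply: ge_inf; last by exists x.
by exists 0 => _ [y _ <-]; exact: hnorm_ge0.
Qed.

Lemma minimum_modulus_ge0 D (A : V -> V) : 0 <= mm D A.
Proof.
rewrite /minimum_modulus; set E := [set _ | _ in _].
(* With no unit vector in [D], [inf] takes its default value 0. *)
have [En0|/set0P/negP/negPn/eqP ->] := pselect (E !=set0); last by rewrite inf0.
by apply: lb_le_inf => // _ [y _ <-]; exact: hnorm_ge0.
Qed.

Lemma minimum_modulus_eq D (A : V -> V) x0 : D x0 -> N x0 = 1 ->
  (forall x, D x -> N x = 1 -> N (A x0) <= N (A x)) -> N (A x0) = mm D A.
Proof.
move=> Dx0 Nx0 h; apply/le_anti; rewrite minimum_modulus_lb// andbT.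
apply: lb_le_inf; first by exists (N (A x0)), x0.
by move=> _ [x [Dx Nx] <-]; exact: h.
Qed.

Lemma minimum_modulus_adherent D (A : V -> V) e : 0 < e ->
  (exists x, D x /\ N x = 1) -> exists x, [/\ D x, N x = 1 & N (A x) < mm D A + e].
Proof.
move=> e0 [x0 [Dx0 Nx0]].
have [||_ [x [Dx Nx] <-] lt_x] := @inf_adherent _ [set N (A x) | x in [set x | D x /\ N x = 1]] e.
- exact: e0.
- split; first by exists (N (A x0)), x0.
  by exists 0 => _ [y _ <-]; exact: hnorm_ge0.
- by exists x.
Qed.

Lemma minimum_modulus_le D (T : V -> V) x : densely_defined ip D T -> D x ->
  mm D T * N x <= N (T x).
Proof.
move=> [[D0 Dlin] Tlin _] Dx.
have [x0|/eqP xn0] := eqVneq x 0; first by rewrite x0 (hnorm0 Hip) mulr0 hnorm_ge0.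
have Nx0 : 0 < N x.
  by rewrite lt_def hnorm_ge0 andbT; apply/eqP => /(hnorm_eq0 Hip).
have T0 : T 0 = 0.
  by have := Tlin (-1) 0 0 D0 D0; rewrite scaler0 addr0 scaleN1r addNr.
have Dy : D ((N x)^-1%:C%C *: x) by rewrite -[_ *: _]addr0; exact: Dlin.
have := minimum_modulus_lb T Dy (hnorm_normalize xn0).
rewrite -[_ *: x]addr0 (Tlin _ _ _ Dx D0) T0 addr0 (hnormZ_real Hip).
by rewrite ger0_norm ?invr_ge0 ?hnorm_ge0// mulrC ler_pdivlMr.
Qed.

Lemma densely_defined_unit D (T : V -> V) : densely_defined ip D T ->
  infinite_dimensional V -> exists x, D x /\ N x = 1.
Proof.
move=> [[D0 Dlin] _ dense] inf_dim.
(* The empty family spans only 0, so [x] is nonzero; a point of [D] closer to [x] than [N x] is then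
   nonzero too. *)
have [x xn0] := inf_dim 0%N (fun=> 0).
have {}xn0 : x <> 0 by have := xn0 (fun=> 0); rewrite big_ord0.
have Nx0 : 0 < N x.
  by rewrite lt_def hnorm_ge0 andbT; apply/eqP => /(hnorm_eq0 Hip).
have [y [Dy xy]] := dense x (N x) Nx0.
have yn0 : y <> 0 by move=> y0; move: xy; rewrite y0 subr0 ltxx.
exists ((N y)^-1%:C%C *: y); split; last exact: hnorm_normalize.
by rewrite -[_ *: _]addr0; exact: Dlin.
Qed.

End MinimumModulus.

(** * Construction of a small perturbation attaining the minimum modulus *)

(* With Q the projection onto the orthogonal complement of x0, the perturbed
   operator is Q T Q + m <., x0> x0, where m is the minimum modulus of T. *)
Lemma positive_minimum_attaining_perturbation (R : realType) (V : lmodType R[i])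
    (ip : V -> V -> R[i]) (D : set V) (T : V -> V) (s : R) :
  complex_Hilbert_space ip -> positive_closed_operator ip D T -> 0 < s ->
  exists S : {linear V -> V}, (forall x, hnorm ip (S x) <= s * hnorm ip x) /\
    minimum_attaining ip D (fun x => T x + S x).
Proof.
move=> [Hip Hcpl inf_dim] HT s0.
have ddT : densely_defined ip D T by case: HT => [[]].
set m := minimum_modulus ip D T.
have m0 : 0 <= m by exact: minimum_modulus_ge0.
have mT x : D x -> m * hnorm ip x <= hnorm ip (T x) by exact: minimum_modulus_le.
have form := form_lower_bound Hip Hcpl HT m0 mT.
(* With [d <= 1], the square of [N v] is at most [(m + d) ^+ 2 - m ^+ 2 <= d * (2 * m + 1) <= s ^+ 2
   / 16], while [t - m <= d <= s / 2]. The norm of the perturbation is then at most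
   [s / 2 + s / 4 + s / 4]. *)
pose d := Num.min 1 (Num.min (s / 2) (s ^+ 2 / (16 * (2 * m + 1)))).
have den0 : 0 < 16 * (2 * m + 1) by lra.
have d0 : 0 < d by rewrite !lt_min ltr01 !divr_gt0// exprn_gt0.
have d1 : d <= 1 by rewrite ge_min lexx.
have ds : d <= s / 2 by rewrite !ge_min lexx orbT.
have dss : d * (16 * (2 * m + 1)) <= s ^+ 2.
  by rewrite -ler_pdivlMr// !ge_min lexx !orbT.
have [x0 [Dx0 Nx0 Tx0]] := minimum_modulus_adherent T d0 (densely_defined_unit Hip ddT inf_dim).
rewrite -/m in Tx0.
pose t := complex.Re (ip (T x0) x0).
(* Symmetry makes this value equal to its conjugate, hence real. *)
have tE : ip (T x0) x0 = t%:C%C.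
  have := op_symm HT Dx0 Dx0; rewrite (ipC Hip (T x0) x0) /t.
  by case: (ip (T x0) x0) => a b [/eqP]; rewrite -subr_eq0 opprK -mulr2n mulrn_eq0 => /eqP ->.
have mt : m <= t by have := form _ Dx0; rewrite Nx0 expr1n mulr1.
have tT : t <= hnorm ip (T x0).
  by have := cauchy_schwarz Hip (T x0) x0; rewrite Nx0 mulr1.
pose v := T x0 - t%:C%C *: x0.
have Nv : hnorm ip v <= s / 4.
  rewrite -(@ler_pXn2r _ 2)// ?nnegrE ?hnorm_ge0 ?divr_ge0 ?(ltW s0)//.
  have -> : hnorm ip v ^+ 2 = hnorm ip (T x0) ^+ 2 - t ^+ 2.
    rewrite (hnormD_sqr Hip) (hnormN Hip) (hnormZ_real Hip) Nx0 mulr1 real_normK ?num_real//.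
    by rewrite (ipNr Hip) (ipZr Hip) conjc_real ReN ReM_real -/t; ring.
  move: (hnorm ip (T x0)) Tx0 tT => n Tx0 tT; nra.
(* This is Q T Q + m <., x0> x0 - T expanded on [D], with <Tx, x0> rewritten as <x, T x0> so that
   the formula is defined and bounded on all of [V]. *)
pose S0 x := ip x x0 *: (m%:C%C *: x0 - v) - ip x (T x0) *: x0.
have linS0 : linear S0.
  move=> a x y; rewrite /S0 !(ipDl Hip) !(ipZl Hip).
  by rewrite !scalerDl [a *: (_ - _)]scalerBr !scalerA [- (_ *: x0 + _)]opprD addrACA.
have [S SE] := linear_map linS0.
exists S; split.
  move=> x; rewrite SE.
  (* Splitting [T x0] as [v + t x0] leaves three rank-one terms, each with a small coefficient or
     vector. *)
  have -> : S0 x = (m - t)%:C%C *: (ip x x0 *: x0) - ip x x0 *: v - ip x v *: x0.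
    have TE : T x0 = v + t%:C%C *: x0 by rewrite subrK.
    rewrite /S0 TE (ipDr Hip) (ipZr Hip) conjc_real; move: (v) => w.
    rewrite scalerBr !scalerA rmorphB /= mulrBl scalerBl (mulrC (ip x x0)).
    by rewrite [ip x w + _]addrC scalerDl opprD addrACA addrA.
  have b1 := hnorm_rank_one Hip x x0 x0; have b2 := hnorm_rank_one Hip x x0 v.
  have b3 := hnorm_rank_one Hip x v x0.
  rewrite Nx0 ?mulr1 in b1 b2 b3.
  apply: le_trans (hnormD Hip _ _) _; rewrite (hnormN Hip).
  have := hnormD Hip ((m - t)%:C%C *: (ip x x0 *: x0)) (- (ip x x0 *: v)).
  rewrite (hnormN Hip) (hnormZ_real Hip) ler0_norm; last by rewrite subr_le0.
  have := @hnorm_ge0 _ _ ip x; have := @hnorm_ge0 _ _ ip (ip x x0 *: x0); nra.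
have x01 : ip x0 x0 = 1 by rewrite (ip_self Hip) -(hnorm_sqr Hip) Nx0 expr1n.
have ATx0 : T x0 + S x0 = m%:C%C *: x0.
  rewrite SE /S0 x01 -(op_symm HT)// tE scale1r /v opprB addrA addrA.
  by rewrite [t%:C%C *: x0 - _]addrC addrA addrK addrAC subrr add0r.
have Amin x : D x -> m * hnorm ip x <= hnorm ip (T x + S x).
  move=> Dx; have [Nx0'|Nxn0] := eqVneq (hnorm ip x) 0; first by rewrite Nx0' mulr0 hnorm_ge0.
  have Nx : 0 < hnorm ip x by rewrite lt_def Nxn0 hnorm_ge0.
  (* It suffices to bound the form below by [m * N x ^+ 2]. With [y] = Qx, the form at [x] is <Ty,
     y> plus [m] times the squared modulus of [a], and Pythagoras splits [N x ^+ 2] the same way. *)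
  rewrite -(ler_pM2r Nx); apply: le_trans (cauchy_schwarz Hip _ _).
  set a := ip x x0; set y := x - a *: x0.
  have yE : y = (- a) *: x0 + x by rewrite scaleNr addrC.
  have Dy : D y by rewrite yE; apply: (op_sub HT).2.
  have aa0 : 0 <= complex.Re (a * conjc a).
    by have := mulcJ_ge0 a; rewrite lecE => /andP[].
  have TSx : ip (T x + S x) x = ip (T y) y + m%:C%C * (a * conjc a).
    rewrite SE /S0 /v yE (op_linear HT)// -/a.
    rewrite !(ipDl Hip, ipDr Hip, ipNl Hip, ipZl Hip, ipZr Hip).
    rewrite (op_symm HT Dx Dx0) tE (ipC Hip x x0) -/a (ipC Hip x (T x0)).
    by rewrite rmorphN; ring.
  have xy : hnorm ip x ^+ 2 = hnorm ip y ^+ 2 + complex.Re (a * conjc a).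
    rewrite !(hnorm_sqr Hip) -ReD; congr complex.Re.
    rewrite /y !(ipBl Hip, ipBr Hip, ipZl Hip, ipZr Hip) x01 (ipC Hip x x0) -/a.
    by ring.
  rewrite -mulrA -expr2 xy TSx ReD ReM_real mulrDr lerD2r; exact: form.
exists x0; split => //; apply: (@minimum_modulus_eq _ _ _ D (fun x => T x + S x)) => // x Dx Nx.
rewrite ATx0 (hnormZ_real Hip) ger0_norm// Nx0 mulr1.
by have := Amin _ Dx; rewrite Nx mulr1.
Qed.

Theorem theorem3p4 (R : realType) (V : lmodType R[i]) (ip : V -> V -> R[i])
  (HV : complex_Hilbert_space ip) (D : set V) (T : V -> V)
  (HT : positive_closed_operator ip D T) (eps : R) (Heps : 0 < eps) :
  exists S : {linear V -> V},
    [/\ (forall x, hnorm ip (S x) <= eps * hnorm ip x),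
        minimum_attaining ip D (fun x => T x + S x) &
        gap_le ip D (fun x => S x + T x) D T eps].
Proof.
have Hip : is_inner_product ip by case: HV.
(* The first bound controls the norm of [S], the second gives [2 * s <= eps ^+ 2] for the gap. *)
pose s := Num.min eps (eps ^+ 2 / 2).
have s0 : 0 < s by rewrite lt_min Heps divr_gt0// exprn_gt0.
have [S [Sle Smin]] := positive_minimum_attaining_perturbation HV HT s0.
exists S; split => //.
  move=> x; apply: le_trans (Sle x) _.
  by rewrite ler_wpM2r ?hnorm_ge0// ge_min lexx.
apply: (@gap_le_perturbation _ _ _ Hip _ _ _ s) => //; try exact: ltW.
by rewrite mulrC -ler_pdivlMr// ge_min lexx orbT.
Qed.
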